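(* For the classical Stefan problem, i.e. for the case $\alpha=0$, if $\mathrm{Bi}>\frac{1}{\sqrt{12}}$ and $\mathrm{Ste}<\frac{1}{2\,\mathrm{Bi}^2}$, then problem $(\mathrm{P}_{4h})$ has a unique solution, given by $$T_{4h}^{(0)}(x,t)=\theta_\infty\left[A_{4h}^{(0)}\left(1-\frac{x}{s_{4h}^{(0)}(t)}\right)+B_{4h}^{(0)}\left(1-\frac{x}{s_{4h}^{(0)}(t)}\right)^2\right],\qquad s_{4h}^{(0)}(t)=2a\nu_{4h}^{(0)}\sqrt{t},$$ where the constants $A_{4h}^{(0)}$ and $B_{4h}^{(0)}$ are defined as functions of $\nu_{4h}^{(0)}$ by $$A_{4h}^{(0)}=\frac{2(\nu_{4h}^{(0)})^2}{\mathrm{Ste}},\qquad B_{4h}^{(0)}=\frac{2\,\mathrm{Bi}\,\nu_{4h}^{(0)}-A_{4h}^{(0)}\left(1+2\,\mathrm{Bi}\,\nu_{4h}^{(0)}\right)}{2\left(1+\mathrm{Bi}\,\nu_{4h}^{(0)}\right)},$$ and $\nu_{4h}^{(0)}>0$ is the value where the function $$\begin{aligned}E_h^{(0)}(\xi)=\;&\frac{t^{-2}\theta_\infty^2}{60\,\mathrm{Ste}^2\,\xi^2\left(\frac1{\mathrm{Bi}}+\xi\right)^2}\Big\{p^{(0)}(\xi)+\frac{1}{\mathrm{Bi}}\Big[2\xi\left(9\xi^6+(3\,\mathrm{Ste}+25)\xi^4+5(6-\mathrm{Ste})\xi^2-15\,\mathrm{Ste}\right)\Big]\\&+\frac{1}{\mathrm{Bi}^2}\,\xi^2\left(12\xi^4+20\xi^2+15\right)\Big\},\qquad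 \xi>0,\end{aligned}$$ attains its minimum (for every $t>0$), where $$p^{(0)}(\xi)=8\xi^8+2(10+\mathrm{Ste})\xi^6+2(30+5\,\mathrm{Ste}+\mathrm{Ste}^2)\xi^4-10\,\mathrm{Ste}(6+\mathrm{Ste})\xi^2+15\,\mathrm{Ste}^2.$$ Moreover, $\nu_{4h}^{(0)}$ can be obtained as the unique positive root of the polynomial $$\begin{aligned}r_h(\xi)=\;&16\,\mathrm{Bi}^3\xi^9+51\,\mathrm{Bi}^2\xi^8+\left(2\,\mathrm{Bi}^3\mathrm{Ste}+20\,\mathrm{Bi}^3+57\,\mathrm{Bi}\right)\xi^7+\left(7\,\mathrm{Bi}^2\mathrm{Ste}+65\,\mathrm{Bi}^2+24\right)\xi^6\\&+3\,\mathrm{Bi}(3\,\mathrm{Ste}+25)\xi^5+\left(\mathrm{Bi}^2(2\,\mathrm{Ste}^2+15\,\mathrm{Ste}+30)+20\right)\xi^4\\&+5\,\mathrm{Bi}\left(3+(-1+12\,\mathrm{Bi}^2)\mathrm{Ste}+2\,\mathrm{Bi}^2\mathrm{Ste}^2\right)\xi^3+45\,\mathrm{Bi}^2\mathrm{Ste}\,\xi^2\\&+15\,\mathrm{Bi}\,\mathrm{Ste}(1-2\,\mathrm{Bi}^2\mathrm{Ste})\xi-15\,\mathrm{Bi}^2\mathrm{Ste}^2.\end{aligned}$$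
   Context: Here $\alpha=0$. Fix real parameters $k,\rho,c,\gamma,\theta_\infty,h>0$; put $a=\sqrt{k/(\rho c)}$, and define the Stefan number $\mathrm{Ste}=\dfrac{k\theta_\infty}{\gamma a^{2}}$ and the Biot number $\mathrm{Bi}=\dfrac{ah}{k}$. A candidate pair $(T,s)$ consists of a continuous function $s:[0,\infty)\to[0,\infty)$, positive and continuously differentiable on $(0,\infty)$, and a function with quadratic profile in space $$T(x,t)=\theta_\infty\left[A\left(1-\frac{x}{s(t)}\right)+B\left(1-\frac{x}{s(t)}\right)^2\right],\quad 0\le x\le s(t),\ t>0,$$ with real constants $A,B$. The least-squares error of a candidate pair at time $t>0$ is $$E=\theta_\infty^2\tfrac{\dot s(t)^2}{s(t)^2}\left(\tfrac{A^2}{3}+\tfrac{AB}{3}+\tfrac{2B^2}{15}\right)+4a^4\theta_\infty^2\tfrac{B^2}{s(t)^4}-4a^2\theta_\infty^2\tfrac{\dot s(t)}{s(t)^3}B\left(\tfrac A2+\tfrac B3\right),$$ which equals $\dfrac{1}{s(t)}\displaystyle\int_0^{s(t)}\left(\frac{\partial T}{\partial t}-a^2\frac{\partial^2T}{\partial x^2}\right)^2dx$. Problem $(\mathrm{P}_{4h})$ (with $\alpha=0$): among all candidate pairs satisfying, for all $t>0$, (i) $k\frac{\partial T}{\partial x}(0,t)=\frac{h}{\sqrt t}\left[T(0,t)-\theta_\infty\right]$, (ii) $T(s(t),t)=0$, (iii) $k\frac{\partial T}{\partial x}(s(t),t)=-\gamma\dot s(t)$, and (iv) $s(0)=0$, find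 a pair that minimizes the error $E$ for every $t>0$. The superscript $(0)$ refers to $\alpha=0$. *)

(* Defs.v *)
From Stdlib Require Import Reals Lra Psatz.
From Coquelicot Require Import Coquelicot.

Open Scope R_scope.

Definition diffusion_coeff (k rho c : R) : R := sqrt (k / (rho * c)).

Definition Stefan_number (k gamma theta a : R) : R := k * theta / (gamma * a ^ 2).

Definition Biot_number (k h a : R) : R := a * h / k.

Definition profile (theta A B : R) (s : R -> R) (x t : R) : R :=
  theta * (A * (1 - x / s t) + B * (1 - x / s t) ^ 2).

(* A temperature [T x t] is only meaningful for [0 <= x <= s t] and [0 < t],
   and a free boundary [s t] only for [0 <= t]; nothing below depends on the
   values outside these domains.  Continuity on [0, +oo) is therefore relative
   to the half-line, and the spatial derivatives at the two ends of [0, s t]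
   are one-sided. *)
Definition is_right_derive (f : R -> R) (x l : R) : Prop :=
  filterlim (fun y => (f y - f x) / (y - x)) (at_right x) (locally l).

Definition is_left_derive (f : R -> R) (x l : R) : Prop :=
  filterlim (fun y => (f y - f x) / (y - x)) (at_left x) (locally l).

Record free_boundary (s : R -> R) : Prop := {
  fb_nonneg : forall t, 0 <= t -> 0 <= s t;
  fb_continuous : forall t, 0 <= t ->
    filterlim s (within (fun u => 0 <= u) (locally t)) (locally (s t));
  fb_positive : forall t, 0 < t -> 0 < s t;
  fb_derivable : forall t, 0 < t -> ex_derive s t;
  fb_derive_continuous : forall t, 0 < t -> continuous (Derive s) t
}.

(* [A] and [B] are determined by the pair [(T, s)], since [0 < s t]. *)
Definition candidate (theta : R) (T : R -> R -> R) (s : R -> R) (A B : R) : Prop :=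
  free_boundary s /\
  forall x t, 0 < t -> 0 <= x <= s t -> T x t = profile theta A B s x t.

Record admissible (k gamma theta h : R) (T : R -> R -> R) (s : R -> R) (A B : R)
  : Prop := {
  adm_candidate : candidate theta T s A B;
  adm_convective : forall t, 0 < t ->
    exists d, is_right_derive (fun x => T x t) 0 d /\
      k * d = h / sqrt t * (T 0 t - theta);
  adm_melting : forall t, 0 < t -> T (s t) t = 0;
  adm_stefan : forall t, 0 < t ->
    exists d, is_left_derive (fun x => T x t) (s t) d /\
      k * d = - gamma * Derive s t;
  adm_initial : s 0 = 0
}.

Definition ls_error (theta a A B : R) (s : R -> R) (t : R) : R :=
  theta ^ 2 * ((Derive s t) ^ 2 / s t ^ 2)
    * (A ^ 2 / 3 + A * B / 3 + 2 * B ^ 2 / 15)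
  + 4 * a ^ 4 * theta ^ 2 * (B ^ 2 / s t ^ 4)
  - 4 * a ^ 2 * theta ^ 2 * (Derive s t / s t ^ 3) * B * (A / 2 + B / 3).

Definition is_solution (k gamma theta h a : R) (T : R -> R -> R) (s : R -> R)
  : Prop :=
  exists A B, admissible k gamma theta h T s A B /\
    forall T' s' A' B', admissible k gamma theta h T' s' A' B' ->
      forall t, 0 < t -> ls_error theta a A B s t <= ls_error theta a A' B' s' t.

Definition same_pair (T1 : R -> R -> R) (s1 : R -> R)
    (T2 : R -> R -> R) (s2 : R -> R) : Prop :=
  (forall t, 0 <= t -> s1 t = s2 t) /\
  (forall x t, 0 < t -> 0 <= x <= s1 t -> T1 x t = T2 x t).

Definition A4h (Ste nu : R) : R := 2 * nu ^ 2 / Ste.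

Definition B4h (Ste Bi nu : R) : R :=
  (2 * Bi * nu - A4h Ste nu * (1 + 2 * Bi * nu)) / (2 * (1 + Bi * nu)).

Definition s4h (a nu t : R) : R := 2 * a * nu * sqrt t.

Definition T4h (theta a Ste Bi nu : R) : R -> R -> R :=
  profile theta (A4h Ste nu) (B4h Ste Bi nu) (s4h a nu).

Definition p0 (Ste xi : R) : R :=
  8 * xi ^ 8 + 2 * (10 + Ste) * xi ^ 6
  + 2 * (30 + 5 * Ste + Ste ^ 2) * xi ^ 4
  - 10 * Ste * (6 + Ste) * xi ^ 2 + 15 * Ste ^ 2.

Definition E_h (theta Ste Bi t xi : R) : R :=
  / t ^ 2 * theta ^ 2 / (60 * Ste ^ 2 * xi ^ 2 * (1 / Bi + xi) ^ 2) *
  (p0 Ste xi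
   + 1 / Bi * (2 * xi * (9 * xi ^ 6 + (3 * Ste + 25) * xi ^ 4
                         + 5 * (6 - Ste) * xi ^ 2 - 15 * Ste))
   + 1 / Bi ^ 2 * xi ^ 2 * (12 * xi ^ 4 + 20 * xi ^ 2 + 15)).

Definition r_h (Ste Bi xi : R) : R :=
  16 * Bi ^ 3 * xi ^ 9 + 51 * Bi ^ 2 * xi ^ 8
  + (2 * Bi ^ 3 * Ste + 20 * Bi ^ 3 + 57 * Bi) * xi ^ 7
  + (7 * Bi ^ 2 * Ste + 65 * Bi ^ 2 + 24) * xi ^ 6
  + 3 * Bi * (3 * Ste + 25) * xi ^ 5
  + (Bi ^ 2 * (2 * Ste ^ 2 + 15 * Ste + 30) + 20) * xi ^ 4
  + 5 * Bi * (3 + (-1 + 12 * Bi ^ 2) * Ste + 2 * Bi ^ 2 * Ste ^ 2) * xi ^ 3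
  + 45 * Bi ^ 2 * Ste * xi ^ 2
  + 15 * Bi * Ste * (1 - 2 * Bi ^ 2 * Ste) * xi
  - 15 * Bi ^ 2 * Ste ^ 2.

Definition minimizes_on_positives (f : R -> R) (x : R) : Prop :=
  0 < x /\ forall y, 0 < y -> f x <= f y.

Definition positive_root (f : R -> R) (x : R) : Prop := 0 < x /\ f x = 0.

Lemma candidate_derive_t theta T s A B t x :
  candidate theta T s A B -> 0 < t -> 0 < x < s t ->
  Derive (fun u => T x u) t =
  theta * (A + 2 * B * (1 - x / s t)) * (x * Derive s t / s t ^ 2).
Proof.
intros [fb prof] ht hx.
assert (ds : ex_derive s t) by now apply (fb_derivable s fb).
assert (cs : continuous s t) by now apply (ex_derive_continuous (V := R_NormedModule)).
rewrite (Derive_ext_loc _ (fun u => profile theta A B s x u)).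
- apply is_derive_unique; unfold profile; auto_derive.
  + repeat split; auto; lra.
  + change (Derive (fun x0 => s x0) t) with (Derive s t); field; lra.
- generalize (filter_and _ _ (open_gt 0 t ht)
    (cs _ (open_gt x (s t) (proj2 hx)))).
  apply filter_imp; intros u [hu hs]; apply prof; auto; split; lra.
Qed.

Lemma candidate_derive_xx theta T s A B t x :
  candidate theta T s A B -> 0 < t -> 0 < x < s t ->
  Derive_n (fun y => T y t) 2 x = 2 * theta * B / s t ^ 2.
Proof.
intros [fb prof] ht hx.
rewrite (Derive_n_ext_loc _ (fun y => profile theta A B s y t)).
- simpl; rewrite (Derive_ext _
    (fun y => theta * (- A / s t - 2 * B / s t * (1 - y / s t)))).
  + apply is_derive_unique; auto_derive; [easy | field; lra].
  + intros y; apply is_derive_unique; unfold profile; auto_derive;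
      [easy | field; lra].
- generalize (filter_and _ _ (open_gt 0 x (proj1 hx))
    (open_lt (s t) x (proj2 hx))).
  apply filter_imp; intros y [h0 h1]; apply prof; auto; split; lra.
Qed.

Lemma ls_error_integral theta a T s A B t :
  candidate theta T s A B -> 0 < t ->
  ls_error theta a A B s t =
  / s t * RInt (fun x =>
      (Derive (fun u => T x u) t - a ^ 2 * Derive_n (fun y => T y t) 2 x) ^ 2)
    0 (s t).
Proof.
intros cand ht.
assert (hs : 0 < s t) by (apply (fb_positive s (proj1 cand)); auto).
set (L := s t) in *; set (D := Derive s t).
rewrite (RInt_ext _ (fun x => (theta * (A + 2 * B * (1 - x / L))
    * (x * D / L ^ 2) - a ^ 2 * (2 * theta * B / L ^ 2)) ^ 2)).
2: { intros x; rewrite Rmin_left, Rmax_right by lra; intros hx.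
     now rewrite (candidate_derive_t theta T s A B),
       (candidate_derive_xx theta T s A B). }
set (p := theta * (A + 2 * B) * D / L ^ 2).
set (q := - (2 * theta * B * D / L ^ 3)).
set (r := - (a ^ 2 * (2 * theta * B / L ^ 2))).
rewrite (RInt_ext _ (fun x => (r + p * x + q * x ^ 2) ^ 2)).
2: { intros x _; unfold p, q, r; apply (f_equal (fun z => z ^ 2)).
     field; lra. }
set (F := fun x => r ^ 2 * x + p * r * x ^ 2 + (p ^ 2 + 2 * q * r) / 3 * x ^ 3
            + p * q / 2 * x ^ 4 + q ^ 2 / 5 * x ^ 5).
assert (I : is_RInt (fun x => (r + p * x + q * x ^ 2) ^ 2) 0 L
              (minus (F L) (F 0))).
{ apply (is_RInt_derive F).
  - intros x _; unfold F; auto_derive; [easy | field].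
  - intros x _; apply (ex_derive_continuous (V := R_NormedModule));
      auto_derive; easy. }
rewrite (is_RInt_unique _ _ _ _ I).
unfold minus, plus, opp; simpl; unfold F, p, q, r, ls_error; fold L D.
field; lra.
Qed.

(* Main.v *)
(* The Stefan condition makes s s' constant, namely k theta A / gamma, so s^2 is linear
   in t and s = 2 a nu sqrt t; the Stefan and convective conditions then express A and B
   through nu.  The admissible pairs thus form a one-parameter family, on which the error
   at time t is E_h(nu).  The derivative of E_h has the sign of r_h.  The hypotheses on Bi
   and Ste make every non-constant coefficient of r_h positive, while r_h(0) < 0, so r_h
   has exactly one positive root, and it is the strict global minimum of E_h. *)
Require Import Defs.
From Stdlib Require Import Reals Lra.
From Coquelicot Require Import Coquelicot.
Open Scope R_scope.

(** * One-sided derivatives and their transfer from the profile to [T] *)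

Lemma is_derive_slope (f : R -> R) (x l : R) :
  is_derive f x l ->
  filterlim (fun y => (f y - f x) / (y - x)) (locally' x) (locally l).
Proof.
intros D; apply is_derive_Reals in D.
apply filterlim_locally; intros eps.
destruct (D eps (cond_pos eps)) as [d Hd].
exists d; intros y Hy Hxy.
change (Rabs (y - x) < d) in Hy.
change (Rabs ((f y - f x) / (y - x) - l) < eps).
replace y with (x + (y - x)) at 1 by ring.
apply Hd; [lra | exact Hy].
Qed.

Lemma is_derive_right_derive (f : R -> R) (x l : R) :
  is_derive f x l -> is_right_derive f x l.
Proof.
intros D; eapply filterlim_filter_le_1; [| exact (is_derive_slope f x l D)].
intros P [e He]; exists e; intros y Hy xy; apply He; [exact Hy | lra].
Qed.

Lemma is_derive_left_derive (f : R -> R) (x l : R) :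
  is_derive f x l -> is_left_derive f x l.
Proof.
intros D; eapply filterlim_filter_le_1; [| exact (is_derive_slope f x l D)].
intros P [e He]; exists e; intros y Hy xy; apply He; [exact Hy | lra].
Qed.

(** [T] is known to agree with the differentiable [profile] only on [[0, s t]], so agreement on one
    side has to carry over the derivative at an end point. *)
Lemma is_right_derive_ext (f g : R -> R) (x b l : R) : x < b ->
  (forall y, x <= y <= b -> f y = g y) ->
  is_right_derive f x l -> is_right_derive g x l.
Proof.
intros xb E; apply filterlim_ext_loc; unfold at_right, within.
generalize (open_lt b x xb); apply filter_imp; intros y yb xy.
rewrite (E y), (E x); auto; lra.
Qed.

Lemma is_left_derive_ext (f g : R -> R) (x b l : R) : b < x ->
  (forall y, b <= y <= x -> f y = g y) ->
  is_left_derive f x l -> is_left_derive g x l.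
Proof.
intros xb E; apply filterlim_ext_loc; unfold at_left, within.
generalize (open_gt b x xb); apply filter_imp; intros y yb xy.
rewrite (E y), (E x); auto; lra.
Qed.

(** Limits along the proper filter [at_right x] are unique. This identifies the slope [d] that
    admissibility only asserts to exist. *)
Lemma is_right_derive_unique (f : R -> R) (x l1 l2 : R) :
  is_right_derive f x l1 -> is_right_derive f x l2 -> l1 = l2.
Proof. intros; eapply (filterlim_locally_unique (F := at_right x)); eauto. Qed.

Lemma is_left_derive_unique (f : R -> R) (x l1 l2 : R) :
  is_left_derive f x l1 -> is_left_derive f x l2 -> l1 = l2.
Proof. intros; eapply (filterlim_locally_unique (F := at_left x)); eauto. Qed.

Lemma is_derive_profile (theta A B : R) (s : R -> R) (x t : R) : 0 < s t ->
  is_derive (fun y => profile theta A B s y t) x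
    (- theta * (A + 2 * B * (1 - x / s t)) / s t).
Proof. intros hs; unfold profile; auto_derive; [easy | field; lra]. Qed.

(** * Constancy and strict minima from the mean value theorem *)

Lemma constant_on_positives (f : R -> R) :
  (forall t, 0 < t -> is_derive f t 0) ->
  forall u t, 0 < u -> 0 < t -> f u = f t.
Proof.
intros D.
assert (C : forall u t, 0 < u -> u < t -> f u = f t).
{ intros u t hu ut.
  destruct (MVT_cor2 f (fun _ => 0) u t ut) as [c [Hc _]].
  - intros c hc; apply is_derive_Reals, D; lra.
  - lra. }
intros u t hu ht; destruct (Rtotal_order u t) as [H | [-> | H]]; auto.
symmetry; now apply C.
Qed.

(** The mean value point lies strictly between [x] and [m], where the sign of [df] is known. *)
Lemma strict_minimum (f df : R -> R) (m : R) : 0 < m ->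
  (forall x, 0 < x -> is_derive f x (df x)) ->
  (forall x, 0 < x < m -> df x < 0) -> (forall x, m < x -> 0 < df x) ->
  forall x, 0 < x -> x <> m -> f m < f x.
Proof.
intros hm D neg pos x hx xm.
destruct (Rdichotomy _ _ xm) as [H | H].
- destruct (MVT_cor2 f df x m H) as [c [Hc Ic]].
  + intros c hc; apply is_derive_Reals, D; lra.
  + assert (df c < 0) by (apply neg; lra); nra.
- destruct (MVT_cor2 f df m x H) as [c [Hc Ic]].
  + intros c hc; apply is_derive_Reals, D; lra.
  + assert (0 < df c) by (apply pos; lra); nra.
Qed.

(** * The square-root law of the free boundary *)

(** [s t ^ 2 - 2 * K * t] has zero derivative at positive times; continuity at 0 and [s 0 = 0] make
    the constant vanish. *)
Lemma free_boundary_sqr_linear (s : R -> R) (K : R) : free_boundary s -> s 0 = 0 ->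
  (forall t, 0 < t -> s t * Derive s t = K) ->
  forall t, 0 <= t -> s t ^ 2 = 2 * K * t.
Proof.
intros fb s0 ode t ht.
destruct (Rle_lt_or_eq_dec _ _ ht) as [ht' | <-]; [| rewrite s0; ring].
set (f := fun u => s u ^ 2 - 2 * K * u).
assert (cst : forall u, 0 < u -> f u = f t).
{ intros u hu; apply (constant_on_positives f); auto.
  intros v hv; unfold f; auto_derive.
  - now apply fb_derivable.
  - change (Derive (fun x => s x) v) with (Derive s v).
    rewrite <- (ode v hv); ring. }
assert (ls : filterlim s (at_right 0) (locally 0)).
{ generalize (fb_continuous s fb 0 (Rle_refl 0)); rewrite s0.
  apply filterlim_filter_le_1; intros P [e He]; exists e; intros u Hu u0.
  apply He; [exact Hu | lra]. }
(* The right limit of [s ^ 2] at 0 is computed twice, by continuity and by constancy of [f];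
   comparing the values gives [f t = 0]. *)
assert (l1 : filterlim (fun u => s u ^ 2) (at_right 0) (locally (0 ^ 2))).
{ apply (filterlim_comp _ _ _ s (fun y => y ^ 2) _ _ _ ls).
  apply (ex_derive_continuous (V := R_NormedModule) (fun y => y ^ 2)).
  auto_derive; easy. }
assert (l2 : filterlim (fun u => s u ^ 2) (at_right 0)
               (locally (2 * K * 0 + f t))).
{ apply (filterlim_ext_loc (fun u => 2 * K * u + f t)).
  - exists (mkposreal 1 Rlt_0_1); intros u _ hu.
    rewrite <- (cst u hu); unfold f; ring.
  - eapply filterlim_filter_le_1; [apply filter_le_within |].
    apply (ex_derive_continuous (V := R_NormedModule)
      (fun u => 2 * K * u + f t)); auto_derive; easy. }
assert (e := filterlim_locally_unique _ _ _ l1 l2).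
unfold f in e; lra.
Qed.

Lemma is_derive_s4h (a nu t : R) : 0 < t ->
  is_derive (s4h a nu) t (a * nu / sqrt t).
Proof.
intros ht; assert (0 < sqrt t) by now apply sqrt_lt_R0.
unfold s4h; auto_derive; [easy | field; lra].
Qed.

Lemma s4h_pos (a nu t : R) : 0 < a -> 0 < nu -> 0 < t -> 0 < s4h a nu t.
Proof.
intros ha hnu ht; assert (0 < sqrt t) by now apply sqrt_lt_R0.
unfold s4h; repeat apply Rmult_lt_0_compat; lra.
Qed.

Lemma free_boundary_s4h (a nu : R) : 0 < a -> 0 < nu -> free_boundary (s4h a nu).
Proof.
intros ha hnu; split.
- intros t ht; unfold s4h; assert (p := sqrt_pos t).
  repeat apply Rmult_le_pos; lra.
- intros t ht.
  (* [sqrt] is 0 on negative reals, hence continuous at 0 from both sides, and the full limit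
     restricts to the half-line. *)
  eapply filterlim_filter_le_1; [apply filter_le_within |].
  apply (continuous_scal_r (K := R_AbsRing) (V := R_NormedModule) (2 * a * nu)).
  apply continuous_sqrt.
- intros t; now apply s4h_pos.
- intros t ht; eexists; now apply is_derive_s4h.
- intros t ht.
  apply (continuous_ext_loc _ (fun u => a * nu / sqrt u)).
  + generalize (open_gt 0 t ht); apply filter_imp; intros u hu; symmetry.
    now apply is_derive_unique, is_derive_s4h.
  + assert (0 < sqrt t) by now apply sqrt_lt_R0.
    apply (ex_derive_continuous (V := R_NormedModule) (fun u => a * nu / sqrt u)).
    auto_derive; split; auto; split; auto; lra.
Qed.

(** * Boundary conditions as equations for [A], [B] and [s] *)

(** The profile has slopes [- theta * (A + 2 * B) / s t] at 0 and [- theta * A / s t] at [s t],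
    value [theta * (A + B)] at 0, and value 0 at [s t], which is the melting condition. *)
Lemma admissible_conditions (k gamma theta h : R) T s A B : 0 < theta ->
  candidate theta T s A B -> s 0 = 0 ->
  (admissible k gamma theta h T s A B <->
   (forall t, 0 < t ->
      - k * (A + 2 * B) / s t = h / sqrt t * (A + B - 1)) /\
   (forall t, 0 < t -> k * theta * A / s t = gamma * Derive s t)).
Proof.
intros htheta cand s0; destruct (cand) as [fb prof].
assert (sp := fb_positive s fb).
assert (R0 : forall t, 0 < t -> is_right_derive (fun x => T x t) 0
               (- theta * (A + 2 * B) / s t)).
{ intros t ht; assert (ht' := sp t ht).
  apply (is_right_derive_ext (fun x => profile theta A B s x t) _ 0 (s t)); auto.
  - intros y hy; symmetry; auto.
  - replace (_ / _) with (- theta * (A + 2 * B * (1 - 0 / s t)) / s t)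
      by (field; lra).
    now apply is_derive_right_derive, is_derive_profile. }
assert (L0 : forall t, 0 < t -> is_left_derive (fun x => T x t) (s t)
               (- theta * A / s t)).
{ intros t ht; assert (ht' := sp t ht).
  apply (is_left_derive_ext (fun x => profile theta A B s x t) _ (s t) 0); auto.
  - intros y hy; symmetry; auto.
  - replace (_ / _) with (- theta * (A + 2 * B * (1 - s t / s t)) / s t)
      by (field; lra).
    now apply is_derive_left_derive, is_derive_profile. }
assert (T0 : forall t, 0 < t -> T 0 t = theta * (A + B)).
{ intros t ht; assert (ht' := sp t ht); rewrite prof by lra.
  unfold profile; field; lra. }
split.
- intros adm; split; intros t ht; assert (ht' := sp t ht).
  + destruct (adm_convective _ _ _ _ _ _ _ _ adm t ht) as [d [Hd e]].
    rewrite (is_right_derive_unique _ _ _ _ Hd (R0 t ht)), T0 in e by auto.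
    apply (Rmult_eq_reg_l theta); [| lra].
    transitivity (h / sqrt t * (theta * (A + B) - theta)); [| ring].
    rewrite <- e; field; lra.
  + destruct (adm_stefan _ _ _ _ _ _ _ _ adm t ht) as [d [Hd e]].
    rewrite (is_left_derive_unique _ _ _ _ Hd (L0 t ht)) in e.
    transitivity (- (k * (- theta * A / s t))); [field; lra | lra].
- intros [conv stef]; split; auto.
  + intros t ht; assert (ht' := sp t ht); eexists; split; [now apply R0 |].
    rewrite T0 by auto.
    transitivity (theta * (- k * (A + 2 * B) / s t)); [field; lra |].
    rewrite conv by auto; ring.
  + intros t ht; assert (ht' := sp t ht); rewrite prof by lra.
    unfold profile; field; lra.
  + intros t ht; assert (ht' := sp t ht); eexists; split; [now apply L0 |].
    transitivity (- (k * theta * A / s t)); [field; lra |].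
    rewrite stef by auto; ring.
Qed.

(** * Admissible pairs as a one-parameter family *)

Section Corollary.

Variables k gamma theta h a : R.
Hypotheses (hk : 0 < k) (hgamma : 0 < gamma) (htheta : 0 < theta) (hh : 0 < h)
  (ha : 0 < a).
Let Ste := Stefan_number k gamma theta a.
Let Bi := Biot_number k h a.

Lemma Stefan_number_pos : 0 < Ste.
Proof.
unfold Ste, Stefan_number; apply Rdiv_lt_0_compat.
- now apply Rmult_lt_0_compat.
- apply Rmult_lt_0_compat; [| apply pow_lt]; auto.
Qed.

Lemma Biot_number_pos : 0 < Bi.
Proof. now apply Rdiv_lt_0_compat; [apply Rmult_lt_0_compat |]. Qed.

Lemma admissible_T4h (nu : R) : 0 < nu ->
  admissible k gamma theta h (T4h theta a Ste Bi nu) (s4h a nu)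
    (A4h Ste nu) (B4h Ste Bi nu).
Proof.
intros hnu; assert (hS := Stefan_number_pos); assert (hB := Biot_number_pos).
apply admissible_conditions; auto.
- split; [now apply free_boundary_s4h | easy].
- unfold s4h; rewrite sqrt_0; ring.
- assert (0 < 1 + Bi * nu) by nra.
  split; intros t ht; assert (0 < sqrt t) by now apply sqrt_lt_R0.
  (* With [h] written through [Bi], the convective condition becomes the linear equation solved by
     [B4h]. *)
  + replace h with (Bi * k / a) by (unfold Bi, Biot_number; field; lra).
    unfold B4h, s4h; field; lra.
  + rewrite (is_derive_unique _ _ _ (is_derive_s4h a nu t ht)).
    unfold s4h, A4h, Ste, Stefan_number; field; lra.
Qed.

Lemma admissible_inv T s A B : admissible k gamma theta h T s A B ->
  exists nu, 0 < nu /\ A = A4h Ste nu /\ B = B4h Ste Bi nu /\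
    forall t, 0 <= t -> s t = s4h a nu t.
Proof.
intros adm; assert (hS := Stefan_number_pos); assert (hB := Biot_number_pos).
assert (cand := adm_candidate _ _ _ _ _ _ _ _ adm).
assert (s0 := adm_initial _ _ _ _ _ _ _ _ adm).
destruct (proj1 (admissible_conditions k gamma theta h T s A B htheta cand s0) adm)
  as [conv stef].
destruct cand as [fb prof]; assert (sp := fb_positive s fb).
(* The Stefan condition gives [s * s' = k * theta * A / gamma], which equals [Ste * A * a ^ 2]. *)
assert (sqr : forall t, 0 <= t -> s t ^ 2 = 2 * (Ste * A * a ^ 2) * t).
{ apply free_boundary_sqr_linear; auto; intros t ht; assert (ht' := sp t ht).
  apply (Rmult_eq_reg_l gamma); [| lra].
  transitivity (s t * (gamma * Derive s t)); [ring |].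
  rewrite <- stef by auto; unfold Ste, Stefan_number; field; lra. }
(* Positivity of [s 1 ^ 2 = 2 * Ste * A * a ^ 2] forces the sign of [A]. *)
assert (hA : 0 < A).
{ assert (e := sqr 1 Rle_0_1); assert (p := pow_lt _ 2 (sp 1 Rlt_0_1)).
  assert (0 < Ste * a ^ 2) by (apply Rmult_lt_0_compat; [| apply pow_lt]; auto).
  nra. }
(* This inverts [A = 2 * nu ^ 2 / Ste], and makes [(2 * a * nu) ^ 2] the slope of [s ^ 2]. *)
set (nu := sqrt (Ste * A / 2)).
assert (hnu : 0 < nu) by (apply sqrt_lt_R0; nra).
assert (nu2 : nu ^ 2 = Ste * A / 2) by (apply pow2_sqrt; nra).
assert (es : forall t, 0 <= t -> s t = s4h a nu t).
{ intros t ht; apply Rsqr_inj.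
  - now apply (fb_nonneg s fb).
  - now apply (fb_nonneg _ (free_boundary_s4h a nu ha hnu)).
  - rewrite 2!Rsqr_pow2, sqr by auto; unfold s4h.
    rewrite !Rpow_mult_distr, nu2, pow2_sqrt by auto; field. }
assert (eA : A = A4h Ste nu) by (unfold A4h; rewrite nu2; field; lra).
exists nu; repeat split; auto.
(* Both sides of the convective condition scale like [1 / sqrt t], so the time 1 already determines
   [B]. *)
rewrite eA in conv; specialize (conv 1 Rlt_0_1).
rewrite es, sqrt_1 in conv by lra; unfold s4h in conv; rewrite sqrt_1 in conv.
replace h with (Bi * k / a) in conv by (unfold Bi, Biot_number; field; lra).
assert (0 < 1 + Bi * nu) by nra.
unfold B4h; set (A' := A4h Ste nu) in *.
apply (Rmult_eq_reg_r (2 * (1 + Bi * nu))); [| lra].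
transitivity (2 * Bi * nu - A' * (1 + 2 * Bi * nu)); [| field; lra].
assert (e : - (A' + 2 * B) = 2 * Bi * nu * (A' + B - 1)); [| lra].
transitivity (- k * (A' + 2 * B) / (2 * a * nu * 1) * (2 * a * nu / k));
  [field; lra | rewrite conv; field; lra].
Qed.

(** * The error along the family and its derivative *)

Lemma ls_error_s4h (nu t : R) : 0 < nu -> 0 < t ->
  ls_error theta a (A4h Ste nu) (B4h Ste Bi nu) (s4h a nu) t =
  E_h theta Ste Bi t nu.
Proof.
intros hnu ht; assert (hS := Stefan_number_pos); assert (hB := Biot_number_pos).
unfold ls_error; rewrite (is_derive_unique _ _ _ (is_derive_s4h a nu t ht)).
unfold E_h, s4h, p0.
assert (hq : 0 < sqrt t) by now apply sqrt_lt_R0.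
(* Expressing [t] through its square root [q] turns the goal into an identity of rational functions,
   within reach of [field]. *)
replace (/ t ^ 2) with (/ (sqrt t ^ 2) ^ 2) by (rewrite pow2_sqrt; lra).
set (q := sqrt t) in *; clearbody q.
unfold B4h, A4h.
clearbody Ste Bi.
assert (0 < 1 + Bi * nu) by nra.
field; lra.
Qed.

End Corollary.

(** A positive time has a neighbourhood of positive times, so the two-sided [Derive] sees only the
    common values. *)
Lemma ls_error_ext (theta a A B : R) (s1 s2 : R -> R) (t : R) : 0 < t ->
  (forall u, 0 <= u -> s1 u = s2 u) ->
  ls_error theta a A B s1 t = ls_error theta a A B s2 t.
Proof.
intros ht e; unfold ls_error.
rewrite (e t), (Derive_ext_loc s1 s2 t); [easy | | lra].
generalize (open_gt 0 t ht); apply filter_imp; intros u hu; apply e; lra.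
Qed.

(** By the quotient rule; the factor before [r_h] is positive when [theta] is nonzero, so [r_h]
    carries the sign. *)
Lemma is_derive_E_h (theta Ste Bi t x : R) : 0 < Ste -> 0 < Bi -> 0 < t -> 0 < x ->
  is_derive (E_h theta Ste Bi t) x
    (theta ^ 2 / (30 * t ^ 2 * Ste ^ 2 * x ^ 3 * (1 + Bi * x) ^ 3)
       * r_h Ste Bi x).
Proof.
intros hS hB ht hx; assert (0 < 1 + Bi * x) by nra.
assert (0 < 1 / Bi) by (apply Rdiv_lt_0_compat; lra).
assert (0 < 60 * Ste ^ 2 * x ^ 2 * (1 / Bi + x) ^ 2)
  by (repeat apply Rmult_lt_0_compat; try apply pow_lt; lra).
unfold E_h, p0; auto_derive; [simpl in *; lra | unfold r_h; field; lra].
Qed.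

(** * The positive root of [r_h] *)

(** Compared term by term. The bound on [Bi] gives the sign of the cubic coefficient, the bound on
    [2 * Bi ^ 2 * Ste] that of the linear one; the quadratic term supplies strictness. *)
Lemma r_h_increasing (Ste Bi x y : R) : 0 < Ste -> 0 < Bi ->
  1 < 12 * Bi ^ 2 -> 2 * Bi ^ 2 * Ste < 1 -> 0 < x < y ->
  r_h Ste Bi x < r_h Ste Bi y.
Proof.
intros hS hB hB12 hSB hxy.
assert (mono : forall c n, 0 <= c -> c * x ^ n <= c * y ^ n).
{ intros c n hc; apply Rmult_le_compat_l; auto; apply pow_incr; lra. }
assert (p2 : 0 < Bi ^ 2) by now apply pow_lt.
assert (p3 : 0 < Bi ^ 3) by now apply pow_lt.
assert (q2 : 0 < Ste ^ 2) by now apply pow_lt.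
assert (0 < Bi * Ste) by nra.
assert (0 < Bi ^ 2 * Ste) by nra.
assert (0 < Bi ^ 3 * Ste) by nra.
assert (0 < Bi ^ 2 * Ste ^ 2) by nra.
assert (c9 := mono (16 * Bi ^ 3) 9%nat ltac:(lra)).
assert (c8 := mono (51 * Bi ^ 2) 8%nat ltac:(lra)).
assert (c7 := mono (2 * Bi ^ 3 * Ste + 20 * Bi ^ 3 + 57 * Bi) 7%nat ltac:(lra)).
assert (c6 := mono (7 * Bi ^ 2 * Ste + 65 * Bi ^ 2 + 24) 6%nat ltac:(lra)).
assert (c5 := mono (3 * Bi * (3 * Ste + 25)) 5%nat ltac:(lra)).
assert (c4 := mono (Bi ^ 2 * (2 * Ste ^ 2 + 15 * Ste + 30) + 20) 4%nat ltac:(lra)).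
assert (c3 := mono (5 * Bi * (3 + (-1 + 12 * Bi ^ 2) * Ste + 2 * Bi ^ 2 * Ste ^ 2))
  3%nat ltac:(apply Rmult_le_pos; nra)).
assert (c2 : 45 * Bi ^ 2 * Ste * x ^ 2 < 45 * Bi ^ 2 * Ste * y ^ 2).
{ apply Rmult_lt_compat_l; nra. }
assert (c1 := mono (15 * Bi * Ste * (1 - 2 * Bi ^ 2 * Ste))
  1%nat ltac:(apply Rmult_le_pos; lra)).
rewrite !pow_1 in c1.
unfold r_h; lra.
Qed.

Lemma r_h_root (Ste Bi : R) : 0 < Ste -> 0 < Bi ->
  1 < 12 * Bi ^ 2 -> 2 * Bi ^ 2 * Ste < 1 ->
  exists nu, positive_root (r_h Ste Bi) nu.
Proof.
intros hS hB hB12 hSB.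
assert (p2 : 0 < Bi ^ 2) by now apply pow_lt.
assert (q2 : 0 < Ste ^ 2) by now apply pow_lt.
assert (r0 : r_h Ste Bi 0 < 0) by (unfold r_h; ring_simplify; nra).
assert (hq : 0 < sqrt Ste) by now apply sqrt_lt_R0.
(* At [sqrt Ste] the quadratic term equals [45 * Bi ^ 2 * Ste ^ 2] and outweighs the constant
   [- 15 * Bi ^ 2 * Ste ^ 2]; the other terms are positive. *)
assert (r1 : 0 < r_h Ste Bi (sqrt Ste)).
{ set (q := sqrt Ste) in *.
  assert (e : q ^ 2 = Ste) by (apply pow2_sqrt; lra); clearbody q.
  assert (pn : forall n, 0 < q ^ n) by (intros n; now apply pow_lt).
  unfold r_h; rewrite e.
  assert (p3 : 0 < Bi ^ 3) by now apply pow_lt.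
  assert (0 < Bi * Ste) by nra.
  assert (0 < Bi ^ 2 * Ste) by nra.
  assert (0 < Bi ^ 3 * Ste) by nra.
  assert (0 < Bi ^ 2 * Ste ^ 2) by nra.
  assert (0 < 16 * Bi ^ 3 * q ^ 9) by (apply Rmult_lt_0_compat; auto; lra).
  assert (0 < 51 * Bi ^ 2 * q ^ 8) by (apply Rmult_lt_0_compat; auto; lra).
  assert (0 < (2 * Bi ^ 3 * Ste + 20 * Bi ^ 3 + 57 * Bi) * q ^ 7)
    by (apply Rmult_lt_0_compat; auto; lra).
  assert (0 < (7 * Bi ^ 2 * Ste + 65 * Bi ^ 2 + 24) * q ^ 6)
    by (apply Rmult_lt_0_compat; auto; lra).
  assert (0 < 3 * Bi * (3 * Ste + 25) * q ^ 5)
    by (apply Rmult_lt_0_compat; auto; lra).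
  assert (0 < (Bi ^ 2 * (2 * Ste ^ 2 + 15 * Ste + 30) + 20) * q ^ 4)
    by (apply Rmult_lt_0_compat; auto; lra).
  assert (0 < 5 * Bi * (3 + (-1 + 12 * Bi ^ 2) * Ste + 2 * Bi ^ 2 * Ste ^ 2) * q ^ 3)
    by (apply Rmult_lt_0_compat; auto; apply Rmult_lt_0_compat; nra).
  assert (0 < 15 * Bi * Ste * (1 - 2 * Bi ^ 2 * Ste) * q)
    by (apply Rmult_lt_0_compat; auto; apply Rmult_lt_0_compat; lra).
  lra. }
destruct (IVT (r_h Ste Bi) 0 (sqrt Ste)) as [z [hz ez]]; auto.
- intros x; apply continuity_pt_filterlim.
  apply (ex_derive_continuous (V := R_NormedModule) (r_h Ste Bi)).
  unfold r_h; auto_derive; easy.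
- exists z; split; auto.
  (* The intermediate value theorem only gives [0 <= z]; the value 0 is excluded by [r0]. *)
  destruct (proj1 hz) as [H | <-]; lra.
Qed.

(** * Existence and uniqueness of the minimizing pair *)

Theorem corollary5p3 (k rho c gamma theta h : R)
    (hk : 0 < k) (hrho : 0 < rho) (hc : 0 < c)
    (hgamma : 0 < gamma) (htheta : 0 < theta) (hh : 0 < h) :
  let a := diffusion_coeff k rho c in
  let Ste := Stefan_number k gamma theta a in
  let Bi := Biot_number k h a in
  Bi > 1 / sqrt 12 ->
  Ste < 1 / (2 * Bi ^ 2) ->
  exists nu : R,
    0 < nu /\
    (forall t, 0 < t -> unique (minimizes_on_positives (E_h theta Ste Bi t)) nu) /\
    unique (positive_root (r_h Ste Bi)) nu /\
    is_solution k gamma theta h a (T4h theta a Ste Bi nu) (s4h a nu) /\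
    (forall T s, is_solution k gamma theta h a T s ->
       same_pair T s (T4h theta a Ste Bi nu) (s4h a nu)).
Proof.
intros a Ste Bi hBi hSte.
assert (ha : 0 < a).
{ apply sqrt_lt_R0, Rdiv_lt_0_compat; auto; now apply Rmult_lt_0_compat. }
assert (hS : 0 < Ste) by now apply Stefan_number_pos.
assert (hB : 0 < Bi) by now apply Biot_number_pos.
assert (hB12 : 1 < 12 * Bi ^ 2).
{ assert (q : 0 < sqrt 12) by (apply sqrt_lt_R0; lra).
  assert (q2 : sqrt 12 ^ 2 = 12) by (apply pow2_sqrt; lra).
  assert (i : 1 < Bi * sqrt 12).
  { apply (Rmult_lt_compat_r _ _ _ q) in hBi.
    now replace (1 / sqrt 12 * sqrt 12) with 1 in hBi by (field; lra). }
  rewrite <- q2; nra. }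
assert (hSB : 2 * Bi ^ 2 * Ste < 1).
{ assert (p : 0 < 2 * Bi ^ 2) by lra.
  apply (Rmult_lt_compat_l _ _ _ p) in hSte.
  now replace (2 * Bi ^ 2 * (1 / (2 * Bi ^ 2))) with 1 in hSte by (field; lra). }
destruct (r_h_root Ste Bi hS hB hB12 hSB) as [nu [hnu root]].
assert (incr := fun x y => r_h_increasing Ste Bi x y hS hB hB12 hSB).
(* Since [r_h] increases strictly through its root, the derivative of [E_h] is negative before [nu]
   and positive after it. *)
assert (smin : forall t, 0 < t -> forall x, 0 < x -> x <> nu ->
          E_h theta Ste Bi t nu < E_h theta Ste Bi t x).
{ intros t ht.
  assert (coef : forall x, 0 < x ->
    0 < theta ^ 2 / (30 * t ^ 2 * Ste ^ 2 * x ^ 3 * (1 + Bi * x) ^ 3)).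
  { intros x hx; assert (0 < 1 + Bi * x) by nra.
    apply Rdiv_lt_0_compat; [now apply pow_lt |].
    do 4 (apply Rmult_lt_0_compat; [| now apply pow_lt]); lra. }
  apply (strict_minimum _ _ _ hnu
    (fun x hx => is_derive_E_h theta Ste Bi t x hS hB ht hx)).
  - intros x hx; assert (p := coef x (proj1 hx)); assert (i := incr x nu hx); nra.
  - intros x hx; assert (p := coef x (Rlt_trans _ _ _ hnu hx)).
    assert (i := incr nu x (conj hnu hx)); nra. }
assert (wmin : forall t, 0 < t -> forall x, 0 < x ->
          E_h theta Ste Bi t nu <= E_h theta Ste Bi t x).
{ intros t ht x hx; destruct (Req_dec x nu) as [-> | n]; [lra |].
  now apply Rlt_le, smin. }
(* Minimizing over admissible pairs is thereby reduced to minimizing [E_h] over positive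
   parameters. *)
assert (err : forall T s A B, admissible k gamma theta h T s A B ->
  exists nu', 0 < nu' /\ A = A4h Ste nu' /\ B = B4h Ste Bi nu' /\
    (forall t, 0 <= t -> s t = s4h a nu' t) /\
    forall t, 0 < t -> ls_error theta a A B s t = E_h theta Ste Bi t nu').
{ intros T s A B adm.
  destruct (admissible_inv k gamma theta h a hk hgamma htheta hh ha T s A B adm)
    as [nu' [hnu' [eA [eB es]]]].
  exists nu'; repeat split; auto; intros t ht.
  rewrite (ls_error_ext _ _ _ _ _ _ _ ht es), eA, eB.
  now apply ls_error_s4h. }
exists nu; split; [exact hnu |]; split; [| split; [| split]].
- intros t ht; split; [split; auto |].
  intros x [hx mx]; destruct (Req_dec x nu) as [-> | n]; auto.
  specialize (mx nu hnu); specialize (smin t ht x hx n); lra.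
- split; [now split |]; intros x [hx rx].
  destruct (Rtotal_order nu x) as [H | [H | H]]; auto.
  + specialize (incr nu x (conj hnu H)); lra.
  + specialize (incr x nu (conj hx H)); lra.
- exists (A4h Ste nu), (B4h Ste Bi nu); split; [now apply admissible_T4h |].
  intros T' s' A' B' adm t ht.
  destruct (err T' s' A' B' adm) as [nu' [hnu' [_ [_ [_ e]]]]].
  rewrite (e t ht).
  unfold Ste, Bi; rewrite ls_error_s4h by auto; now apply wmin.
- intros T s [A [B [adm opt]]].
  destruct (err T s A B adm) as [nu' [hnu' [eA [eB [es e]]]]].
  (* Comparison with the explicit pair at the single time 1 suffices, because the minimum of [E_h]
     is strict. *)
  assert (eq : nu' = nu).
  { destruct (Req_dec nu' nu) as [| n]; auto.
    specialize (opt _ _ _ _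
      (admissible_T4h k gamma theta h a hk hgamma htheta hh ha nu hnu) 1 Rlt_0_1).
    rewrite (e 1 Rlt_0_1), ls_error_s4h in opt by (auto; lra).
    specialize (smin 1 Rlt_0_1 nu' hnu' n); fold Ste Bi in opt; lra. }
  rewrite eq in *; split; auto.
  intros x t ht hx.
  rewrite (proj2 (adm_candidate _ _ _ _ _ _ _ _ adm) x t ht hx).
  unfold T4h, profile; rewrite eA, eB, es by lra; reflexivity.
Qed.
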